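(* Let $s,t$ be positive integers and $r=s+4$. Let $T^{r}_{s,t}$ be the tree with vertex set $\{v_0,v_1,v_2,v_3,v_4\}\cup\{p_1,\ldots,p_s\}\cup\{q_1,\ldots,q_s\}\cup\{w_1,\ldots,w_t\}$ (all distinct) and edge set $\{v_0v_1,v_1v_2,v_2v_3,v_3v_4\}\cup\{p_iq_i: 1\le i\le s\}\cup\{v_2w_i:1\le i\le t\}\cup\{v_2p_i:1\le i\le s\}$. Then $\gamma(T^{r}_{s,t})=\nu_2(T^{r}_{s,t})-1$.
   Context: For a graph $G$, $\gamma(G)$ is the domination number: the minimum size of a set $D\subseteq V(G)$ such that every vertex is in $D$ or adjacent to a vertex of $D$. A 2-packing is a set $R\subseteq E(G)$ such that no three edges of $R$ are incident with a common vertex; $\nu_2(G)$ is the maximum size of a 2-packing. *)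

(* Defs.v *)
From HB Require Import structures.
From mathcomp Require Import all_boot.

Set Implicit Arguments.
Unset Strict Implicit.
Unset Printing Implicit Defensive.

Record sgraph := SGraph {
  vertex :> finType;
  adj : rel vertex;
  adj_sym : symmetric adj;
  adj_irrefl : irreflexive adj
}.

Definition edges (G : sgraph) : {set {set G}} :=
  [set [set x; y] | x in G, y in G & adj x y].

Definition dominating (G : sgraph) (D : {set G}) : bool :=
  [forall v, (v \in D) || [exists u in D, adj v u]].

Lemma dominating_setT (G : sgraph) : dominating [set: G].
Proof. by apply/forallP => v; rewrite in_setT. Qed.

(* By dominating_setT the default value [set: G] is itself dominating, so this
   is a genuine minimum. *)
Definition domination_number (G : sgraph) : nat :=
  #|[arg min_(D < [set: G] | dominating D) #|D|]|.

Definition two_packing (G : sgraph) (R : {set {set G}}) : bool :=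
  (R \subset edges G) && [forall v : G, #|[set f in R | v \in f]| < 3].

Definition nu2 (G : sgraph) : nat := \max_(R | @two_packing G R) #|R|.

(* The indices of p, q and w are shifted to start at 0. *)
Inductive tree_vertex (s t : nat) :=
  | Tv of 'I_5
  | Tp of 'I_s
  | Tq of 'I_s
  | Tw of 'I_t.

Definition tree_vertex_code s t (x : tree_vertex s t) :
    'I_5 + 'I_s + 'I_s + 'I_t :=
  match x with
  | Tv i => inl (inl (inl i))
  | Tp i => inl (inl (inr i))
  | Tq i => inl (inr i)
  | Tw i => inr i
  end.

Definition tree_vertex_decode s t (x : 'I_5 + 'I_s + 'I_s + 'I_t) :
    tree_vertex s t :=
  match x with
  | inl (inl (inl i)) => Tv s t i
  | inl (inl (inr i)) => Tp t i
  | inl (inr i) => Tq t i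
  | inr i => Tw s i
  end.

Lemma tree_vertex_codeK s t :
  cancel (@tree_vertex_code s t) (@tree_vertex_decode s t).
Proof. by case. Qed.

HB.instance Definition _ s t :=
  Finite.copy (tree_vertex s t) (can_type (@tree_vertex_codeK s t)).

(* Each edge of the tree in one orientation. *)
Definition tree_arc s t (x y : tree_vertex s t) : bool :=
  match x, y with
  | Tv i, Tv j => j == i.+1 :> nat
  | Tp i, Tq j => i == j
  | Tv i, Tw _ => i == 2 :> nat
  | Tv i, Tp _ => i == 2 :> nat
  | _, _ => false
  end.

Definition tree_adj s t : rel (tree_vertex s t) :=
  fun x y => tree_arc x y || tree_arc y x.

Lemma tree_adj_sym s t : symmetric (@tree_adj s t).
Proof. by move=> x y; rewrite /tree_adj orbC. Qed.

Lemma tree_adj_irrefl s t : irreflexive (@tree_adj s t).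
Proof. by case=> i //; rewrite /tree_adj /= orbb ltn_eqF. Qed.

Definition tree (s t : nat) : sgraph :=
  SGraph (@tree_adj_sym s t) (@tree_adj_irrefl s t).

(* Main.v *)
Require Import Defs.
From HB Require Import structures.
From mathcomp Require Import all_boot all_order all_algebra.
From mathcomp Require Import zify.

Set Implicit Arguments.
Unset Strict Implicit.
Unset Printing Implicit Defensive.

(** Both invariants are computed.  The closed neighbourhoods of [v_0], [v_4],
    [w_1] and the [q_i] are pairwise disjoint, so every dominating set has at
    least [s + 3] vertices, a bound attained by [v_1], [v_2], [v_3] and the
    [p_i].  Only [s + 2] edges avoid [v_2], and a 2-packing has at most two
    edges at [v_2], so it has at most [s + 4] edges; the path [v_0 ... v_4]
    together with the edges [p_i q_i] attains this bound. *)

Lemma domination_number_le (G : sgraph) (D : {set G}) :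
  dominating D -> domination_number G <= #|D|.
Proof.
move=> domD; rewrite /domination_number.
by case: arg_minnP => [|D' _ minD']; [exact: dominating_setT | exact: minD'].
Qed.

(* The hypothesis says that the closed neighbourhoods of the [x i] are
   disjoint, [c] telling which of them a vertex belongs to. *)
Lemma domination_number_ge (G : sgraph) (I : finType) (x : I -> G)
    (c : G -> I) :
  (forall i u, (u == x i) || adj (x i) u -> c u = i) ->
  #|I| <= domination_number G.
Proof.
move=> cP; rewrite /domination_number.
case: arg_minnP => [|D domD _]; first exact: dominating_setT.
(* Since [D] meets the closed neighbourhood of every [x i], [c] maps [D] onto [I]. *)
apply: leq_trans (leq_imset_card c (mem D)).
rewrite -cardsT; apply: subset_leq_card; apply/subsetP => i _.
have /orP[xD | /exists_inP[u uD xu]] := forallP domD (x i).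
  by apply/imsetP; exists (x i); rewrite // (cP i) ?eqxx.
by apply/imsetP; exists u; rewrite // (cP i) ?xu ?orbT.
Qed.

Lemma edgesP (G : sgraph) (f : {set G}) :
  reflect (exists x y, adj x y /\ f = [set x; y]) (f \in edges G).
Proof.
apply: (iffP imset2P) => [[x y _]|[x [y [xy ->]]]].
  by rewrite inE => /andP[_ xy] ->; exists x, y.
by exists x y; rewrite // inE xy andbT.
Qed.

Lemma nu2_ge (G : sgraph) (R : {set {set G}}) : two_packing R -> #|R| <= nu2 G.
Proof. by move=> packR; rewrite /nu2 (bigD1 R) //= leq_maxl. Qed.

(** The edges of a 2-packing that avoid [v] lie in [E], and at most two others pass through [v]. *)
Lemma nu2_le (G : sgraph) (v : G) (E : {set {set G}}) :
  (forall f, f \in edges G -> v \notin f -> f \in E) -> nu2 G <= #|E| + 2.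
Proof.
move=> EP; apply/bigmax_leqP => R /andP[/subsetP subR /forallP degR].
have splitR : R \subset E :|: [set f in R | v \in f].
  apply/subsetP => f fR; rewrite in_setU inE fR /=.
  by case: (boolP (v \in f)) => [_|vf]; rewrite ?orbT // EP ?subR.
apply: leq_trans (subset_leq_card splitR) _.
by apply: leq_trans (leq_card_setU _ _) _; rewrite leq_add2l -ltnS degR.
Qed.

Section Tree.
Variables s t : nat.
Implicit Types (i : 'I_s) (u : tree s t).

Local Notation v k := (Tv s t (@Ordinal 5 k isT) : tree s t).

Lemma eq_Tv (j k : 'I_5) : ((Tv s t j : tree s t) == Tv s t k) = (j == k).
Proof. by []. Qed.

Lemma eq_Tp i i' : ((Tp t i : tree s t) == Tp t i') = (i == i').
Proof. by []. Qed.

Lemma eq_Tq i i' : ((Tq t i : tree s t) == Tq t i') = (i == i').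
Proof. by []. Qed.

(** The shift [j.+1] selects [v_1], [v_2], [v_3]. As the image of a type with [s + 3] elements, the
    dominating set needs no injectivity for its size bound. *)
Definition center (k : 'I_s + 'I_3) : tree s t :=
  match k with
  | inl i => Tp t i
  | inr j => Tv s t (inord j.+1)
  end.

Lemma dominating_center : dominating [set center k | k in setT].
Proof.
have inC k : center k \in [set center k' | k' in setT] by exact: imset_f.
have inV (j : 'I_5) :
    0 < j < 4 -> (Tv s t j : tree s t) \in [set center k' | k' in setT].
  move=> j04; have lt3 : j.-1 < 3 by lia.
  have := inC (inr (Ordinal lt3)); rewrite /= prednK; last by lia.
  by rewrite inord_val.
apply/forallP => -[j|i|i|k]; apply/orP.
- case: (posnP j) => [j0|jpos].
    by right; apply/exists_inP; exists (v 1); rewrite ?inV //= /tree_adj /= j0.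
  have [j4|j4] := ltnP j 4; first by left; rewrite inV ?jpos.
  right; apply/exists_inP; exists (v 3); rewrite ?inV //= /tree_adj /=.
  by have := ltn_ord j; lia.
- by left; exact: (inC (inl i)).
- right; apply/exists_inP; exists (Tp t i); first exact: (inC (inl i)).
  by rewrite /= /tree_adj /= eqxx.
- by right; apply/exists_inP; exists (v 2); rewrite ?inV.
Qed.

(** The index [w] is a parameter because ['I_t] may be empty; the assumption [0 < t] supplies it
    later. *)
Definition leaf (w : 'I_t) (k : 'I_s + 'I_3) : tree s t :=
  match k with
  | inl i => Tq t i
  | inr j => tnth [tuple v 0; Tw s w : tree s t; v 4] j
  end.

(** The sum of booleans sends [v_0], [v_1] to 0, [v_2] to 1 and [v_3], [v_4] to 2, matching the
    order of the tuple in [leaf]. *)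
Definition leaf_class u : 'I_s + 'I_3 :=
  match u with
  | Tv j => inr (inord ((1 < j) + (2 < j)))
  | Tp i | Tq i => inl i
  | Tw _ => inr (inord 1)
  end.

Lemma leaf_classP (w : 'I_t) k u :
  (u == leaf w k) || adj (leaf w k) u -> leaf_class u = k.
Proof.
case: k => [i|[[|[|[|//]]] lt3]]; case: u => [j|i'|i'|w'] //=; rewrite ?orbF.
- by rewrite /tree_adj /= => /eqP ->.
- by move=> /eqP[->].
- rewrite eq_Tv -val_eqE /tnth /= /tree_adj /= orbF => j01.
  by congr inr; apply: val_inj; rewrite /= inordK; lia.
- rewrite /tnth /= /tree_adj /= => /eqP ->.
  by congr inr; apply: val_inj; rewrite /= inordK.
- by move=> _; congr inr; apply: val_inj; rewrite /= inordK.
- rewrite eq_Tv -val_eqE /tnth /= /tree_adj /= => j34.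
  have lt5 := ltn_ord j.
  by congr inr; apply: val_inj; rewrite /= inordK; lia.
Qed.

Lemma domination_number_tree : 0 < t -> domination_number (tree s t) = s + 3.
Proof.
move=> t_gt0; apply/eqP; rewrite eqn_leq; apply/andP; split.
  apply: leq_trans (domination_number_le dominating_center) _.
  by apply: leq_trans (leq_imset_card _ _) _; rewrite cardsT card_sum !card_ord.
have := domination_number_ge (@leaf_classP (Ordinal t_gt0)).
by rewrite card_sum !card_ord.
Qed.

(** In the second case [widen_ord] gives [v_j] and [lift ord0] gives [v_(j+1)], so these are the
    four path edges. *)
Definition packing_edge (k : 'I_s + 'I_4) : {set tree s t} :=
  match k with
  | inl i => [set (Tp t i : tree s t); Tq t i]
  | inr j => [set (Tv s t (widen_ord (leqnSn 4) j) : tree s t);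
                  Tv s t (lift ord0 j)]
  end.

Lemma packing_edge_inj : injective packing_edge.
Proof.
move=> [i|j] [i'|j'] E.
- have := set21 (Tp t i : tree s t) (Tq t i); rewrite -/(packing_edge (inl i)) E.
  by rewrite !inE eq_Tp orbF => /eqP ->.
- by have := set21 (Tp t i : tree s t) (Tq t i);
    rewrite -/(packing_edge (inl i)) E !inE.
- by have := set21 (Tp t i' : tree s t) (Tq t i');
    rewrite -/(packing_edge (inl i')) -E !inE.
(* The lower end of each path edge lies on the other: [j'] is [j] or [j + 1] and [j] is [j'] or
   [j' + 1], which forces [j = j']. *)
- have := set21 (Tv s t (widen_ord (leqnSn 4) j) : tree s t) (Tv s t (lift ord0 j)).
  have := set21 (Tv s t (widen_ord (leqnSn 4) j') : tree s t) (Tv s t (lift ord0 j')).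
  rewrite -/(packing_edge (inr j)) -/(packing_edge (inr j')) E -{1}E.
  rewrite !inE !eq_Tv -!val_eqE /= /bump /= => jj' j'j.
  by congr inr; apply: val_inj; rewrite /=; lia.
Qed.

Lemma packing_edge_in k : packing_edge k \in edges (tree s t).
Proof.
apply/edgesP; case: k => [i|j].
  by exists (Tp t i), (Tq t i); rewrite /= /tree_adj /= eqxx.
exists (Tv s t (widen_ord (leqnSn 4) j)), (Tv s t (lift ord0 j)); split=> //=.
by rewrite /tree_adj /= /bump /= add1n eqxx.
Qed.

(* At [v_0] and [v_4] one of the two indices listed is spurious. *)
Definition packing_star u : {set 'I_s + 'I_4} :=
  match u with
  | Tv j => [set inr (inord j.-1); inr (inord j)]
  | Tp i | Tq i => [set inl i]
  | Tw _ => set0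
  end.

Lemma packing_starP u k : u \in packing_edge k -> k \in packing_star u.
Proof.
case: u => [j|i|i|w]; case: k => [i'|j']; rewrite ?inE //=.
- rewrite !eq_Tv -!val_eqE !(inj_eq (@inr_inj _ _)) /= /bump /=.
  case/orP => /eqP ->; last by rewrite add1n inord_val eqxx.
  by rewrite inord_val eqxx orbT.
- by rewrite eq_Tp orbF eq_sym.
- by rewrite eq_Tq eq_sym.
Qed.

(** The chosen edges at [u] have their indices in [packing_star u], which has at most two
    elements. *)
Lemma two_packing_tree : @two_packing (tree s t) (packing_edge @: setT).
Proof.
apply/andP; split.
  by apply/subsetP => _ /imsetP[k _ ->]; exact: packing_edge_in.
apply/forallP => u; rewrite ltnS.
have sub : [set f in packing_edge @: setT | u \in f]
    \subset packing_edge @: packing_star u.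
  apply/subsetP => f; rewrite inE => /andP[/imsetP[k _ ->] uk].
  by apply: imset_f; exact: packing_starP.
apply: leq_trans (subset_leq_card sub) _.
apply: leq_trans (leq_imset_card _ _) _.
by case: u {sub} => [j|i|i|w] /=; rewrite ?cards2 ?cards1 ?cards0 //; case: eqP.
Qed.

(** The removed indices 1 and 2 are those of [v_1 v_2] and [v_2 v_3]; every edge outside the packing
    also contains [v_2]. *)
Lemma edge_avoiding_v2 (f : {set tree s t}) :
  f \in edges (tree s t) -> v 2 \notin f ->
  f \in packing_edge @: ~: [set inr (@Ordinal 4 1 isT); inr (@Ordinal 4 2 isT)].
Proof.
move=> /edgesP[x [y [xy ->]]].
wlog xy' : x y {xy} / tree_arc x y => [W|].
  by case/orP: xy => [/W //|/W]; rewrite setUC.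
case: x y xy' => [j|i|i|w] [j'|i'|i'|w'] //= xy'; rewrite !inE negb_or.
- rewrite !eq_Tv -!val_eqE /= => /andP[j2 j'2].
  have lt4 : j < 4 by have := ltn_ord j'; lia.
  apply/imsetP; exists (inr (Ordinal lt4)).
    by rewrite !inE !(inj_eq (@inr_inj _ _)) -!val_eqE /=; lia.
  have wj : widen_ord (leqnSn 4) (Ordinal lt4) = j by exact: val_inj.
  have lj : lift ord0 (Ordinal lt4) = j'.
    by apply: val_inj; rewrite /= /bump /= add1n (eqP xy').
  by rewrite /= wj lj.
- by rewrite eq_Tv -val_eqE /= eq_sym xy'.
- by rewrite eq_Tv -val_eqE /= eq_sym xy'.
- move=> _; rewrite -(eqP xy'); apply/imsetP; exists (inl i) => //.
  by rewrite !inE.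
Qed.

Lemma nu2_tree : nu2 (tree s t) = s + 4.
Proof.
apply/eqP; rewrite eqn_leq; apply/andP; split; last first.
  have := nu2_ge two_packing_tree.
  by rewrite card_imset ?cardsT ?card_sum ?card_ord //; exact: packing_edge_inj.
apply: leq_trans (nu2_le edge_avoiding_v2) _.
(* The two removed indices make up for the two edges allowed at [v_2], so the bound is the full
   index count [s + 4]. *)
have := cardsC [set (inr (@Ordinal 4 1 isT) : 'I_s + 'I_4); inr (@Ordinal 4 2 isT)].
rewrite cards2 card_sum !card_ord /= => <-.
by rewrite addnC leq_add2l leq_imset_card.
Qed.

End Tree.

Local Open Scope ring_scope.

Theorem theorem2p4 (s t r : nat) (hs : (0 < s)%N) (ht : (0 < t)%N)
    (hr : r = (s + 4)%N) :
  (domination_number (tree s t))%:Z = (nu2 (tree s t))%:Z - 1.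
Proof. by rewrite domination_number_tree // nu2_tree; lia. Qed.
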